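(* Let $\mathbb{K}$ be a countable field and suppose that there exists a Følner sequence $(F_n)$ in $(\mathbb{K},+)$ such that $((F_n\setminus\{0\})^{-1})$ is also a Følner sequence in $(\mathbb{K},+)$. Then $\mathbb{K}$ is a union of finite subfields.
   Context: A Følner sequence in a countable abelian group $(A,+)$ is a sequence $(F_n)$ of non-empty finite subsets with $|F_n\cap(F_n+b)|/|F_n| \to 1$ for every $b \in A$. For $S\subset\mathbb{K}^*$, $S^{-1} = \{s^{-1} : s \in S\}$. *)

(* Defs.v *)
From HB Require Import structures.
From mathcomp Require Import all_boot all_order all_algebra finmap.
From mathcomp Require Import all_classical all_reals.
From mathcomp Require Import topology normedtype sequences.

Set Implicit Arguments.
Unset Strict Implicit.
Unset Printing Implicit Defensive.

Import Order.TTheory GRing.Theory Num.Theory.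
Import numFieldNormedType.Exports.

Local Open Scope classical_set_scope.
Local Open Scope ring_scope.

Definition fset_translate (A : zmodType) (S : {fset A}) (b : A) : {fset A} :=
  [fset (x + b)%R | x in S]%fset.

(* The realType R is only where the limit is taken. The ratio is never 0 / 0,
   as the sets are required to be non-empty. *)
Definition Folner (R : realType) (A : zmodType) (F : nat -> {fset A}) : Prop :=
  (forall n, F n != fset0) /\
  (forall b : A,
     (fun n => #|` (F n `&` fset_translate (F n) b)%fset|%:R / #|` F n|%:R : R)
       @ \oo --> (1 : R)).

(* In MathComp 0^-1 = 0, so this is S^{-1} only when 0 is not in S. *)
Definition fset_inv (K : fieldType) (S : {fset K}) : {fset K} :=
  [fset (x^-1)%R | x in S]%fset.

(* GRing.divring_closed asks for 1 and for closure under x - y and x / y,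
   where x / 0 = 0. *)
Definition finite_subfield (K : fieldType) (L : {fset K}) : Prop :=
  GRing.divring_closed (mem L).

(* Main.v *)
Require Import Defs.
From HB Require Import structures.
From mathcomp Require Import all_boot all_order all_algebra finmap.
From mathcomp Require Import all_classical all_reals.
From mathcomp Require Import topology normedtype sequences.
From mathcomp Require Import all_field.
From mathcomp Require Import ring lra zify.

(** A field that is not a union of finite subfields contains a subring O other
    than the field itself such that every x has x or x^-1 in O, that is, it
    carries a nontrivial valuation ring. Such an O rules out the pair of Folner
    sequences.

    - Smallness. For x outside O, the elements 0, x, x^2 lie in different
      cosets of O, so O has three disjoint translates. A finite set E that is
      almost invariant under these three translations therefore has little
      more than a third of its points in O
      ([valuation_ring_translates], [card_three_translates]).
    - Covering. A point of F_n outside O is nonzero and has its inverse in O.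
      Hence F_n has at most as many points as F_n and (F_n \ {0})^-1 have
      together in O, which is little more than 2/3 of |F_n|. This is a
      contradiction ([valuation_ring_not_doubly_Folner]).
    - Existence of O. If a^-1 is not in Z[a], then Zorn's lemma gives a subring
      containing a that is maximal among those avoiding a^-1, and maximality
      makes it a valuation ring ([valuation_ring_exists]).

    So the hypothesis forces a^-1 to lie in Z[a] for every a. The case a = 2
    gives positive characteristic p ([pchar_of_half_int]). For the other
    a <> 0 the relation a * r(a) = 1 makes a a root of the polynomial X * r - 1,
    which is nonzero modulo p because its constant term is -1; thus a is
    algebraic over the prime field and lies in a finite subfield
    ([algebraic_in_finite_subfield]). *)

Set Implicit Arguments.
Unset Strict Implicit.
Unset Printing Implicit Defensive.

Import Order.TTheory GRing.Theory Num.Theory.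
Import numFieldNormedType.Exports.

Local Open Scope classical_set_scope.
Local Open Scope ring_scope.

(** * Subrings and adjunction of an element *)

Definition is_subring (K : fieldType) (O : set K) : Prop :=
  [/\ O 1, forall x y, O x -> O y -> O (x - y)
    & forall x y, O x -> O y -> O (x * y)].

Lemma is_subring0 (K : fieldType) (O : set K) : is_subring O -> O 0.
Proof. by move=> [O1 OB _]; rewrite -(subrr 1); exact: OB. Qed.

Lemma is_subringD (K : fieldType) (O : set K) x y :
  is_subring O -> O x -> O y -> O (x + y).
Proof.
move=> sO Ox Oy; have [O1 OB OM] := sO.
rewrite -[y]opprK; apply: (OB) => //; rewrite -sub0r.
by apply: (OB) => //; exact: is_subring0.
Qed.

Lemma is_subringX (K : fieldType) (O : set K) x n :
  is_subring O -> O x -> O (x ^+ n).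
Proof.
move=> [O1 _ OM] Ox; elim: n => [|n IHn]; first by rewrite expr0.
by rewrite exprS; exact: OM.
Qed.

Lemma is_subring_sum (K : fieldType) (O : set K) I (r : seq I) (P : pred I) F :
  is_subring O -> (forall i, O (F i)) -> O (\sum_(i <- r | P i) F i).
Proof.
move=> sO OF; elim/big_ind: _ => //; first exact: is_subring0.
by move=> x y; exact: is_subringD.
Qed.

Definition adjoin (K : fieldType) (O : set K) (y : K) : set K :=
  [set z | exists p : {poly K}, (forall i, O p`_i) /\ z = p.[y]].

Lemma adjoin_subring (K : fieldType) (O : set K) y :
  is_subring O -> is_subring (adjoin O y).
Proof.
move=> sO; have [O1 OB OM] := sO; split.
- exists 1; rewrite hornerC; split=> // i; rewrite coef1.
  by case: (i == 0)%N => //; exact: is_subring0.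
- move=> _ _ [p [Op ->]] [q [Oq ->]]; exists (p - q).
  by rewrite hornerD hornerN; split=> // i; rewrite coefB; exact: OB.
- move=> _ _ [p [Op ->]] [q [Oq ->]]; exists (p * q).
  rewrite hornerM; split=> // i; rewrite coefM.
  by apply: is_subring_sum => // j; exact: OM.
Qed.

Lemma sub_adjoin (K : fieldType) (O : set K) y :
  is_subring O -> O `<=` adjoin O y.
Proof.
move=> sO x Ox; exists x%:P; rewrite hornerC; split=> // i.
by rewrite coefC; case: (i == 0)%N => //; exact: is_subring0.
Qed.

Lemma mem_adjoin (K : fieldType) (O : set K) y :
  is_subring O -> adjoin O y y.
Proof.
move=> sO; exists 'X; rewrite hornerX; split=> // i; rewrite coefX.
by have [O1 _ _] := sO; case: (i == 1)%N => //; exact: is_subring0.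
Qed.

(** * Existence of a valuation ring *)

(** The maximality is recorded in the only form used later: enlarging O by any
    element brings in a^-1. *)
Lemma exists_maximal_subring (K : fieldType) (A : set K) (a : K) :
  is_subring A -> ~ A a^-1 ->
  exists O : set K, [/\ is_subring O, A `<=` O, ~ O a^-1
    & forall y, ~ O y -> adjoin O y a^-1].
Proof.
move=> sA Aa.
pose good (X : set K) := [/\ is_subring X, A `<=` X & ~ X a^-1].
(* The union of the empty chain is empty, so the empty set has to be allowed;
   it is not maximal, because A is larger. *)
have [|O [PO maxO]] := @Zorn_bigcup K (fun X => X = set0 \/ good X).
  move=> F FP Ftot.
  have [[X FX /set0P X0]|noX] :=
    pselect (exists2 X, F X & X !=set0); last first.
    left; rewrite -subset0 => x [X FX Xx]; apply: noX.
    by exists X => //; exists x.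
  have Fgood Y y : F Y -> Y y -> good Y.
    by move=> FY Yy; have [Y0|//] := FP _ FY; move: Yy; rewrite Y0.
  have Fpair x y : (\bigcup_(X in F) X) x -> (\bigcup_(X in F) X) y ->
      exists Y, [/\ F Y, Y x, Y y & good Y].
    move=> [Y FY Yx] [Z FZ Zy]; have [YZ|ZY] := Ftot _ _ FY FZ.
      by exists Z; split=> //; [exact: YZ|exact: Fgood Zy].
    by exists Y; split=> //; [exact: ZY|exact: Fgood Yx].
  have [x0 Xx0] : exists x, X x by apply/set0P.
  have [[X1 _ _] AX _] := Fgood _ _ FX Xx0.
  right; split.
  - split; first by exists X.
    + move=> x y /Fpair /[apply] -[Y [FY Yx Yy [[_ YB _] _ _]]].
      by exists Y => //; exact: YB.
    + move=> x y /Fpair /[apply] -[Y [FY Yx Yy [[_ _ YM] _ _]]].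
      by exists Y => //; exact: YM.
  - by move=> x /AX Xx; exists X.
  - by move=> [Y FY Ya]; have [_ _] := Fgood _ _ FY Ya; apply.
have {PO} [sO AO Oa] : good O.
  case: PO => // O0; have [A1 _ _] := sA; exfalso.
  apply: (maxO A); last by right; split.
  by rewrite O0; split=> [x []|/(_ _ A1)].
exists O; split=> // y Oy; apply: contrapT => Oya.
apply: (maxO (adjoin O y)).
  split; first exact: sub_adjoin.
  by move=> /(_ _ (mem_adjoin y sO)).
right; split=> //; first exact: adjoin_subring.
by move=> x /AO; exact: sub_adjoin.
Qed.

Section MaximalSubring.
Variables (K : fieldType) (O : set K) (a : K).
Hypotheses (sO : is_subring O) (Oa : O a) (Oa' : ~ O a^-1).
Hypothesis maxO : forall y, ~ O y -> adjoin O y a^-1.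

Let a0 : a != 0.
Proof. by apply/eqP => a0; move: Oa'; rewrite a0 invr0 -a0. Qed.

Let not_1_in_aO c : O c -> a * c <> 1.
Proof.
move=> Oc ac1; apply: Oa'.
by rewrite -[a^-1]mulr1 -ac1 mulKf.
Qed.

(** If the inverse of u = 1 - a d were not in O, then a^-1 would be a polynomial
    in u^-1 over O; clearing denominators puts u^N a^-1 in O. As u^N is 1 modulo
    a O, this would put a^-1 itself in O. *)
Lemma one_sub_unit d : O d -> O (1 - a * d)^-1.
Proof.
have [O1 OB OM] := sO; move=> Od.
have u0 : 1 - a * d != 0.
  by rewrite subr_eq0 eq_sym; apply/eqP; exact: not_1_in_aO.
apply: contrapT => /maxO [p [Op pE]].
have Ou : O (1 - a * d) by apply: (OB) => //; exact: OM.
pose u := 1 - a * d.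
have uX n : exists2 c, O c & u ^+ n = 1 + a * c.
  elim: n => [|n [c Oc IH]].
    by exists 0; rewrite ?mulr0 ?addr0 //; exact: is_subring0.
  exists (c - d - a * (d * c)).
    by do 2?[apply: (OB)=> //]; do 2!apply: (OM) => //.
  by rewrite exprSr IH /u; ring.
have [c Oc uc] := uX (size p).
have : O (u ^+ (size p) * p.[u^-1]).
  rewrite horner_coef big_distrr /=; apply: is_subring_sum => // i.
  rewrite mulrCA; apply: (OM) => //.
  rewrite exprVn -expfB //; exact: is_subringX.
rewrite -pE uc => Oac; apply: Oa'.
have -> : a^-1 = (1 + a * c) * a^-1 - c.
  by rewrite mulrDl mul1r [a * c]mulrC mulfK // addrK.
exact: OB.
Qed.

(** [rep y n]: 1 lies in the span over O of a, a y, ..., a y^n. *)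
Let rep y n := exists p : {poly K},
  [/\ forall i, O p`_i, (size p <= n.+1)%N & a * p.[y] = 1].

Let rep_adjoin y : ~ O y -> exists n, rep y n.
Proof.
move=> /maxO [p [Op pE]]; exists (size p), p; split=> //.
by rewrite -pE mulfV.
Qed.

Let rep0 y : ~ rep y 0.
Proof.
move=> [p [Op /size1_polyC -> ]]; rewrite hornerC; exact: not_1_in_aO.
Qed.

(** Multiplying the relation for y^-1 by y^(n+1) and dividing by the unit
    1 - a q_0 writes y^(n+1) as a times a polynomial in y of degree at most n.
    Substituting this for the leading monomial in the relation for y lowers the
    degree. *)
Lemma rep_decrease y n m : y != 0 -> (m <= n.+1)%N ->
  rep y n.+1 -> rep y^-1 m -> rep y n.
Proof.
have [O1 OB OM] := sO; move=> y0 mn [p [Op sp pE]] [q [Oq sq qE]].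
pose u := 1 - a * q`_0.
have Ou : O u^-1 by exact: one_sub_unit.
have u0 : u != 0.
  by rewrite subr_eq0 eq_sym; apply/eqP; exact: not_1_in_aO.
pose h := \poly_(j < n.+1) (u^-1 * q`_(n.+1 - j)).
have yE : y ^+ n.+1 = a * q`_0 * y ^+ n.+1 +
    a * \sum_(j < n.+1) q`_(n.+1 - j) * y ^+ j.
  have q_sum : q.[y^-1] = \sum_(i < n.+2) q`_i * y^-1 ^+ i.
    by apply: horner_coef_wide; apply: leq_trans sq _.
  rewrite -[LHS]mul1r -qE q_sum big_ord_recl /= expr0 mulr1 mulrDr mulrDl.
  congr (_ + _); rewrite -mulrA mulr_suml; congr (a * _).
  rewrite (reindex_inj rev_ord_inj) /=; apply: eq_bigr => i _.
  rewrite /bump /= add1n subnSK // -mulrA; congr (_ * _).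
  rewrite exprVn -[X in _ * y ^+ X](subnK (ltnW (ltn_ord i))) exprD.
  by rewrite mulKf ?expf_neq0.
have yn : y ^+ n.+1 = a * h.[y].
  apply: (mulfI u0); rewrite [in LHS]/u mulrBl mul1r {1}yE addrAC subrr add0r.
  rewrite mulrCA; congr (a * _); rewrite horner_poly mulr_sumr.
  by apply: eq_bigr => i _; rewrite -!mulrA mulVKf.
pose c := p`_n.+1.
pose f := \poly_(j < n.+1) p`_j + (a * c) *: h.
exists f; split.
- move=> i; rewrite coefD coefZ !coef_poly.
  have O0 := is_subring0 sO.
  apply: is_subringD => //; first by case: ifP.
  apply: (OM); first by apply: (OM) => //; exact: Op.
  by case: ifP => // _; exact: OM.
- rewrite (leq_trans (size_polyD _ _)) // geq_max size_poly.
  by rewrite (leq_trans (size_scale_leq _ _)) // size_poly.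
- rewrite -pE /f hornerD hornerZ [a * c]mulrC -[c * a * _]mulrA -yn.
  by congr (a * _); rewrite (horner_coef_wide _ sp) big_ord_recr /= horner_poly.
Qed.

(** If neither y nor y^-1 is in O, both satisfy a relation [rep]; the longer of
    the two can always be shortened, down to degree 0, where it would make a
    invertible in O. *)
Lemma maximal_subring_valuation y : O y \/ O y^-1.
Proof.
apply: contrapT => /not_orP [Oy Oy'].
have y0 : y != 0.
  by apply/eqP => y0; apply: Oy; rewrite y0; exact: is_subring0.
have [n rn] := rep_adjoin Oy; have [m rm] := rep_adjoin Oy'.
have [N] := ubnP (n + m); elim: N n m y y0 rn rm {Oy Oy'} => // N IHN n m y y0.
wlog mn : n m y y0 / (m <= n)%N.
  move=> wl rn rm; have [mn|/ltnW nm] := leqP m n; first exact: (wl n m y).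
  by rewrite addnC; apply: (wl m n y^-1); rewrite ?invr_eq0 ?invrK.
case: n mn => [_ /rep0 //|n mn rn rm nmN].
by apply: (IHN n m y) => //; exact: rep_decrease rm.
Qed.

End MaximalSubring.

Lemma valuation_ring_exists (K : fieldType) (A : set K) (a : K) :
  is_subring A -> A a -> ~ A a^-1 ->
  exists O : set K,
    [/\ is_subring O, ~ O a^-1 & forall y, O y \/ O y^-1].
Proof.
move=> sA Aa Aa'; have [O [sO AO Oa' maxO]] := exists_maximal_subring sA Aa'.
by exists O; split=> // y; apply: (maximal_subring_valuation sO (AO _ Aa)).
Qed.

(** * Almost invariant finite sets *)

Lemma card_fset_translate (A : zmodType) (F : {fset A}) b :
  #|` fset_translate F b| = #|` F|.
Proof. by rewrite card_imfset //=; exact: addIr. Qed.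

(** The ratio 7/8 leaves room for the count in
    [valuation_ring_not_doubly_Folner]: a set with three disjoint translates
    then gets at most 1/3 + 1/12 < 1/2 of the points. *)
Lemma Folner_near (R : realType) (A : zmodType) (F : nat -> {fset A}) b :
  Folner R F ->
  \forall n \near \oo,
    (7 * #|` F n| <= 8 * #|` (F n `&` fset_translate (F n) b)%fset|)%N.
Proof.
move=> [F0 /(_ b) Fb].
have : \forall n \near \oo, 7 / 8 <
    (#|` (F n `&` fset_translate (F n) b)%fset|%:R / #|` F n|%:R : R).
  by apply: (cvgr_gt (1 : R)) => //; lra.
apply: filterS => n; rewrite ltr_pdivlMr ?ltr0n ?cardfs_gt0 ?F0 // => /ltW h.
rewrite -(ler_nat R) !natrM; lra.
Qed.

(** The translate X + b leaves F in at most |F + b \ F| points, that is, in at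
    most an eighth of |F|. *)
Lemma card_translate_le (A : zmodType) (F X Y : {fset A}) b :
  (7 * #|` F| <= 8 * #|` (F `&` fset_translate F b)%fset|)%N ->
  (X `<=` F)%fset -> (F `&` fset_translate X b `<=` Y)%fset ->
  (8 * #|` X| <= 8 * #|` Y| + #|` F|)%N.
Proof.
move=> Fb XF XY.
have h1 := cardfsID F (fset_translate X b).
have h2 := cardfsID F (fset_translate F b).
have h3 : (#|` (fset_translate X b `\` F)%fset| <=
           #|` (fset_translate F b `\` F)%fset|)%N.
  apply/fsubset_leq_card/fsetSD/fsubsetP => _ /imfsetP[x /= xX ->].
  by apply/imfsetP; exists x => //=; exact: (fsubsetP XF).
have h4 := fsubset_leq_card XY.
move: h1 h2 Fb h4; rewrite !card_fset_translate.
rewrite [(fset_translate X b `&` F)%fset]fsetIC.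
rewrite [(fset_translate F b `&` F)%fset]fsetIC; lia.
Qed.

(** Summing [card_translate_le] over three disjoint translates gives
    24 |X| <= 8 |F| + 3 |F|. *)
Lemma card_three_translates (A : zmodType) (F X : {fset A}) (b : 'I_3 -> A) :
  (forall i, 7 * #|` F| <= 8 * #|` (F `&` fset_translate F (b i))%fset|)%N ->
  (X `<=` F)%fset ->
  (forall i j x y, x \in X -> y \in X -> x + b i = y + b j -> i = j) ->
  (24 * #|` X| <= 11 * #|` F|)%N.
Proof.
move=> Fb XF inj.
pose Y i := (F `&` fset_translate X (b i))%fset.
have XY i : (8 * #|` X| <= 8 * #|` Y i| + #|` F|)%N.
  exact: card_translate_le (Fb i) XF (fsubset_refl _).
have disj i j : i != j -> (Y i `&` Y j = fset0)%fset.
  move=> ij; apply/eqP; rewrite -fsubset0; apply/fsubsetP => z.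
  rewrite !inE => /andP[/andP[_ /imfsetP[x /= xX zx]] /andP[_ /imfsetP[y /= yX zy]]].
  by case/eqP: ij; apply: inj xX yX _; rewrite -zx -zy.
have : (Y 0 `|` (Y 1 `|` Y 2) `<=` F)%fset by rewrite !fsubUset !fsubsetIl.
move=> /fsubset_leq_card; rewrite !cardfsU fsetIUr !disj // fsetU0 !cardfs0 !subn0.
have := XY 0; have := XY 1; have := XY 2; lia.
Qed.

(** If x^2 or x^2 - x were in O, multiplying it by x^-1, which is in O, would
    put x or x - 1, hence x, in O. *)
Lemma valuation_ring_translates (K : fieldType) (O : set K) (x : K) :
  is_subring O -> (forall y, O y \/ O y^-1) -> ~ O x ->
  forall i j : 'I_3, forall y z, O y -> O z ->
    y + nth 0 [:: 0; x; x ^+ 2] i = z + nth 0 [:: 0; x; x ^+ 2] j -> i = j.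
Proof.
move=> sO vO Ox; have [O1 OB OM] := sO.
have Oxi : O x^-1 by case: (vO x).
have x0 : x != 0.
  by apply/eqP => x0; apply: Ox; rewrite x0; exact: is_subring0.
have Ox2 : ~ O (x ^+ 2).
  by move=> Oxx; apply: Ox; rewrite -[x](mulfK x0) -expr2; exact: OM.
have Ox2x : ~ O (x ^+ 2 - x).
  move=> Oxx; apply: Ox; have -> : x = (x ^+ 2 - x) * x^-1 + 1 by field.
  by apply: is_subringD => //; exact: OM.
have eqB y z b c : O y -> O z -> y + b = z + c -> O (b - c).
  move=> Oy Oz e; have -> : b - c = z - y by rewrite -(addKr y b) e; ring.
  exact: OB.
move=> [[|[|[|//]]] ilt] [[|[|[|//]]] jlt] y z Oy Oz /= e;
  apply/val_inj => //=; exfalso;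
  have := eqB _ _ _ _ Oz Oy (esym e); have := eqB _ _ _ _ Oy Oz e;
  rewrite ?subr0; tauto.
Qed.

(** With G = (F \ {0})^-1, the valuation property gives
    |F| <= |F /\ O| + |G /\ O|; the point 0 causes no loss since it is in O. The
    right-hand side is at most 11/24 (|F| + |G|) <= 22/24 |F|. *)
Lemma valuation_ring_not_doubly_Folner (R : realType) (K : fieldType)
    (O : set K) (x : K) (F : nat -> {fset K}) :
  is_subring O -> (forall y, O y \/ O y^-1) -> ~ O x ->
  Folner R F -> Folner R (fun n => fset_inv (F n `\ 0)%fset) -> False.
Proof.
move=> sO vO Ox FF GF.
pose b (i : 'I_3) := nth 0 [:: 0; x; x ^+ 2] i.
pose G n := fset_inv (F n `\ 0)%fset.
have near_all (H : nat -> {fset K}) : Folner R H -> \forall n \near \oo,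
    forall i, (7 * #|` H n| <= 8 * #|` (H n `&` fset_translate (H n) (b i))%fset|)%N.
  by move=> FH; apply: filter_forall => i; exact: Folner_near FH.
have [n [Fn Gn]] : exists n,
    (forall i, 7 * #|` F n| <=
                8 * #|` (F n `&` fset_translate (F n) (b i))%fset|)%N /\
    (forall i, 7 * #|` G n| <=
                8 * #|` (G n `&` fset_translate (G n) (b i))%fset|)%N.
  apply: (@filter_ex _ (\oo : set_system nat)).
  by apply: filterI; exact: near_all.
have third (E : {fset K}) :
    (forall i, 7 * #|` E| <= 8 * #|` (E `&` fset_translate E (b i))%fset|)%N ->
    (24 * #|` [fset y in E | y \in O]%fset| <= 11 * #|` E|)%N.
  move=> Eb; apply: (card_three_translates Eb).
    by apply/fsubsetP => y; rewrite !inE => /andP[].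
  move=> i j y z; rewrite !inE => /andP[_ /set_mem Oy] /andP[_ /set_mem Oz].
  exact: (valuation_ring_translates sO vO Ox).
have GleF : (#|` G n| <= #|` F n|)%N.
  rewrite card_imfset /=; last exact: invr_inj.
  by rewrite fsubset_leq_card // fsubsetDl.
have : (#|` F n| <= #|` [fset y in F n | y \in O]%fset|
                    + #|` [fset y in G n | y \in O]%fset|)%N.
  set FO := [fset y in F n | y \in O]%fset.
  rewrite -(cardfsID FO (F n)) leq_add //.
    by rewrite fsubset_leq_card // fsubsetIr.
  have <- : #|` fset_inv (F n `\` FO)%fset| = #|` (F n `\` FO)%fset|.
    by rewrite card_imfset //; exact: invr_inj.
  apply/fsubset_leq_card/fsubsetP => _ /imfsetP[y /= yF ->].
  move: yF; rewrite !inE => /andP[+ yF]; rewrite yF /= => /negP yO.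
  have Oy : ~ O y by move=> /mem_set.
  apply/andP; split; last by case: (vO y) => // /mem_set.
  apply/imfsetP; exists y => //=; rewrite !inE yF andbT.
  by apply/eqP => y0; apply: Oy; rewrite y0; exact: is_subring0.
have := third _ Fn; have := third _ Gn.
have : (0 < #|` F n|)%N by rewrite cardfs_gt0; case: FF.
lia.
Qed.

(** * Algebraic elements and finite subfields *)

(** Modulo q the powers of X take finitely many values, and a power of a
    depends only on the class of the corresponding power of X. *)
Lemma root_finite_coef_collision (k : finFieldType) (K : fieldType)
    (f : {rmorphism k -> K}) (q : {poly k}) (a : K) (e : nat -> nat) :
  q != 0 -> root (map_poly f q) a ->
  exists i j, (i < j)%N /\ a ^+ (e i) = a ^+ (e j).
Proof.
move=> q0 qa.
pose T := 'rV[k]_(size q).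
pose g (i : 'I_#|T|.+1) : T := poly_rV ('X^(e i) %% q).
have /injectivePn [i [j ij gij]] : ~~ injectiveb g.
  by apply/injectiveP => /leq_card; rewrite card_ord ltnn.
have aX m : a ^+ m = (map_poly f ('X^m %% q)).[a].
  rewrite -[in LHS](hornerXn a m) -[X in X.[a]](map_polyXn f).
  rewrite [in LHS](divp_eq 'X^m q).
  by rewrite rmorphD rmorphM hornerD hornerM (eqP qa) mulr0 add0r.
have aij : a ^+ (e i) = a ^+ (e j).
  have sz m : (size ('X^m %% q)%R <= size q)%N by rewrite ltnW // ltn_modp.
  by rewrite !aX -(poly_rV_K (sz (e i))) -(poly_rV_K (sz (e j))) -/(g i) gij.
have [ltij|ltji|/val_inj/eqP] := ltngtP i j; last by rewrite (negPf ij).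
- by exists i, j.
- by exists j, i.
Qed.

Lemma exprB_pchar (K : fieldType) (p m : nat) (x y : K) :
  p \in [pchar K] -> (x - y) ^+ (p ^ m) = x ^+ (p ^ m) - y ^+ (p ^ m).
Proof.
move=> cp; have pn : [pchar K].-nat (p ^ m)%N.
  by rewrite pnatX (eq_pnat _ (pcharf_eq cp)) pnat_id // (pcharf_prime cp).
by rewrite exprDn_pchar // exprNn_pchar.
Qed.

(** The solutions of x^(p^m) = x are closed under the field operations since
    the map x |-> x^(p^m) is a field morphism, and they are finite in number as
    roots of X^(p^m) - X. *)
Lemma Frobenius_fixed_finite_subfield (K : fieldType) (p m : nat) :
  p \in [pchar K] -> (0 < m)%N ->
  exists L : {fset K}, finite_subfield L /\
    forall x : K, (x \in L) = (x ^+ (p ^ m) == x).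
Proof.
move=> cp m0; pose q := (p ^ m)%N.
have pp : prime p := pcharf_prime cp.
have q1 : (1 < q)%N by rewrite -(exp1n m) ltn_exp2r ?prime_gt1.
pose A : set K := [set x | x ^+ q == x].
have fA : finite_set A.
  apply: contrapT => /infinite_set_fset -/(_ q.+1) [B BA sB].
  have sq : size ('X^q - 'X : {poly K}) = q.+1.
    by rewrite size_polyDl ?size_polyN size_polyXn ?size_polyX.
  have rB : all (root ('X^q - 'X)) B.
    apply/allP => x /BA xq; rewrite rootE !hornerE ?hornerXn subr_eq0.
    exact: xq.
  have q0 : 'X^q - 'X != 0 :> {poly K} by rewrite -size_poly_eq0 sq.
  by have := max_poly_roots q0 rB (fset_uniq B); rewrite sq ltnS leqNgt sB.
exists (fset_set A); have memA x : (x \in fset_set A) = (x ^+ q == x).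
  by rewrite in_fset_set //; apply/idP/idP => [/set_mem|/mem_set].
split=> //; split.
- by rewrite memA expr1n.
- move=> x y; rewrite !memA => /eqP xq /eqP yq.
  by rewrite exprB_pchar // xq yq.
- move=> x y; rewrite !memA => /eqP xq /eqP yq.
  by rewrite expr_div_n xq yq.
Qed.

(** A collision a^(p^i) = a^(p^j) with i < j descends to a^(p^(j - i)) = a, since
    Frobenius is injective. *)
Lemma algebraic_in_finite_subfield (k : finFieldType) (K : fieldType)
    (f : {rmorphism k -> K}) (q : {poly k}) (p : nat) (a : K) :
  p \in [pchar K] -> q != 0 -> root (map_poly f q) a ->
  exists L : {fset K}, finite_subfield L /\ a \in L.
Proof.
move=> cp q0 qa.
have [i [j [ij aij]]] :=
  root_finite_coef_collision (fun i => p ^ i)%N q0 qa.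
have [|L [sL memL]] := @Frobenius_fixed_finite_subfield K p (j - i) cp.
  by rewrite subn_gt0.
exists L; split=> //; rewrite memL -subr_eq0.
have : (a ^+ (p ^ (j - i)) - a) ^+ (p ^ i) == 0.
  rewrite exprB_pchar; last exact: cp.
  by rewrite -exprM -expnD (subnK (ltnW ij)) aij subrr.
by rewrite expf_eq0 => /andP[].
Qed.

Definition int_adjoin (K : fieldType) (a : K) : set K :=
  [set z | exists r : {poly int}, z = (map_poly intr r).[a]].

Lemma int_adjoin_subring (K : fieldType) (a : K) :
  is_subring (int_adjoin a).
Proof.
split.
- by exists 1; rewrite rmorph1 hornerC.
- by move=> _ _ [r ->] [s ->]; exists (r - s); rewrite rmorphB hornerD hornerN.
- by move=> _ _ [r ->] [s ->]; exists (r * s); rewrite rmorphM hornerM.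
Qed.

Lemma mem_int_adjoin (K : fieldType) (a : K) : int_adjoin a a.
Proof. by exists 'X; rewrite map_polyX hornerX. Qed.

(** An element of Z[2] is an integer; if it is an inverse m of 2, the odd, hence
    nonzero, integer 2 m - 1 vanishes in K. *)
Lemma pchar_of_half_int (K : fieldType) :
  int_adjoin (2 : K) 2^-1 -> exists p, p \in [pchar K].
Proof.
move=> [r rE].
have [/eqP two0|two_neq0] := eqVneq (2 : K) 0; first by exists 2%N; rewrite !inE.
have : (2 * r.[2] - 1)%:~R = 0 :> K.
  rewrite rmorphB rmorphM /= -(horner_map (intr : int -> K)) /= -rE.
  by rewrite mulfV // subrr.
have : 2 * r.[2] - 1 != 0 by lia.
move: (2 * r.[2] - 1) => N N0 NK.
apply: (@natf0_pchar K `|N|%N); first by rewrite absz_gt0.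
by rewrite pmulrn abszEsign intrM NK mulr0.
Qed.

(** The relation a * r(a) = 1 is read as an equation over the prime field: the
    polynomial X * r - 1 takes the value -1 at 0, so it stays nonzero modulo p. *)
Lemma finite_subfield_of_inverse_int_adjoin (K : fieldType) (a : K) p :
  p \in [pchar K] -> a != 0 -> int_adjoin a a^-1 ->
  exists L : {fset K}, finite_subfield L /\ a \in L.
Proof.
move=> cp a0 [r rE].
pose k := 'F_p.
pose f : {rmorphism 'F_p -> pPrimeCharType cp} := in_alg (pPrimeCharType cp).
pose q : {poly 'F_p} := 'X * map_poly intr r - 1.
apply: (@algebraic_in_finite_subfield _ _ f q p a cp).
  apply/eqP => /(congr1 (fun s : {poly _} => s.[0])).
  rewrite !hornerE ?mul0r ?sub0r => /eqP; rewrite oppr_eq0 oner_eq0 //.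
rewrite rootE rmorphB rmorphM rmorph1 /= map_polyX.
rewrite -map_poly_comp (eq_map_poly (g := intr)); last first.
  by move=> z; exact: (rmorph_int f).
by rewrite !hornerE -rE mulfV // subrr.
Qed.

Theorem theorem1p9 (R : realType) (K : fieldType)
    (Kcountable : countable [set: K])
    (exF : exists F : nat -> {fset K},
        Folner R F /\ Folner R (fun n => fset_inv (F n `\ 0)%fset)) :
  exists C : set {fset K},
    (forall L : {fset K}, C L -> finite_subfield L) /\
    \bigcup_(L in C) [set` L] = [set: K].
Proof.
have [F [FF GF]] := exF.
have inv_adjoin (a : K) : int_adjoin a a^-1.
  apply: contrapT => Za.
  have [O [sO Oa vO]] := valuation_ring_exists
    (int_adjoin_subring a) (mem_int_adjoin a) Za.
  exact: valuation_ring_not_doubly_Folner sO vO Oa FF GF.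
exists (@finite_subfield K); split=> //.
apply/seteqP; split=> // a _.
have [p cp] := pchar_of_half_int (inv_adjoin 2).
have [->|a0] := eqVneq a 0.
  have [L [sL memL]] := @Frobenius_fixed_finite_subfield K p 1 cp isT.
  exists L => //=; rewrite memL expn1 expr0n.
  by rewrite (negPf (lt0n_neq0 (prime_gt0 (pcharf_prime cp)))).
have [L [sL aL]] := finite_subfield_of_inverse_int_adjoin cp a0 (inv_adjoin a).
by exists L.
Qed.
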